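(* There exist finite simple graphs $G$ and $H$ with $|V(G)| = 4686$ and $|V(H)| = 30$ such that $\chi(G) > 5$ and $\chi(H) > 5$, yet $\chi(G \times H) \leq 5$.
   Context: Here $\chi$ denotes the chromatic number. The tensor product $G \times H$ is the graph with vertex set $V(G) \times V(H)$ in which $(g,h)$ and $(g',h')$ are adjacent if and only if $gg' \in E(G)$ and $hh' \in E(H)$. *)

(* Defs.v *)
From mathcomp Require Import all_boot.

Set Implicit Arguments.
Unset Strict Implicit.
Unset Printing Implicit Defensive.

Record sgraph := SGraph {
  vertex :> finType;
  edge : rel vertex;
  edge_sym : symmetric edge;
  edge_irrefl : irreflexive edge
}.

Definition proper_coloring (G : sgraph) k (c : {ffun G -> 'I_k}) : bool :=
  [forall x : G, forall y : G, edge x y ==> (c x != c y)].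

Definition colorable (G : sgraph) k : bool :=
  [exists c : {ffun G -> 'I_k}, proper_coloring c].

Lemma colorable_card (G : sgraph) : colorable G #|G|.
Proof.
apply/existsP; exists [ffun x => enum_rank x].
apply/forallP => x; apply/forallP => y; apply/implyP => exy.
rewrite !ffunE (inj_eq enum_rank_inj).
by apply: contraTneq exy => ->; rewrite edge_irrefl.
Qed.

Lemma ex_colorable (G : sgraph) : exists k, colorable G k.
Proof. by exists #|G|; apply: colorable_card. Qed.

Definition chromatic_number (G : sgraph) : nat := ex_minn (ex_colorable G).

Definition tensor_edge (G H : sgraph) : rel (G * H) :=
  fun u v => edge u.1 v.1 && edge u.2 v.2.

Lemma tensor_edge_sym (G H : sgraph) : symmetric (@tensor_edge G H).
Proof. by move=> u v; rewrite /tensor_edge edge_sym (edge_sym u.2). Qed.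

Lemma tensor_edge_irrefl (G H : sgraph) : irreflexive (@tensor_edge G H).
Proof. by move=> u; rewrite /tensor_edge edge_irrefl. Qed.

Definition tensor_product (G H : sgraph) : sgraph :=
  SGraph (@tensor_edge_sym G H) (@tensor_edge_irrefl G H).

(* Main.v *)
Require Import Defs.
From mathcomp Require Import all_boot.
From mathcomp Require Import zify.

Set Implicit Arguments.
Unset Strict Implicit.
Unset Printing Implicit Defensive.

(** Let the vertices of a graph H be maps from V(G) to k colours, two maps f
    and g being adjacent only if f x <> g y for every edge xy of G.  Then the
    evaluation (x, f) |-> f x is a proper k-colouring of G x H, whatever G is
    ([tensor_maps_colorable]).  So it suffices to find a graph G without proper
    5-colouring, and thirty maps from G to five colours that also form a graph
    without proper 5-colouring.

    G is the universal graph for 6-colourings in which the two ends of a walk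
    of length 7 never share a colour.  Its vertices are words of six letters;
    the letter in place i plays the role of the distance, cut off at 4, to the
    i-th colour class, which consists of the words with letter 0 in that place.
    What matters for the thirty maps is that the set of vertices at distance at
    most t from a class, in the parity of t, is independent for t <= 3
    ([shell_indep]) and that all its neighbours lie in the next set of this kind
    ([shell_next]).

    G is not 5-colourable for a topological reason ([wide_coloring_bound]).  In
    the complex of vertices of G with signs, where vertices of opposite signs
    must be adjacent to lie in a common simplex, there is an antipodally
    symmetric mod 2 cycle of dimension 5 that behaves like a sphere.  As in the
    combinatorial proof of Ky Fan's theorem, the parity of the number of
    simplices whose signs alternate when sorted by colour passes from each
    dimension to the next ([fan_faces]).  So some simplex of dimension 5
    alternates, and its six vertices have distinct colours.  The spheres are
    built by induction on the number of letters: the old sphere is the equator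
    of the new one, and it bounds a hemisphere because small moves of its
    vertices, one sign at a time, push it into the base of a cone
    ([equator_bounds]).

    The thirty maps are the five constants, a hub, and eight maps for each of
    the three low colours a = 0, 1, 2.  The constants get distinct colours, and
    every other map then gets the colour of a constant that is one of its values
    ([col_image]).  The hub sends two of the six classes to each low colour, so
    it gets one of these, say a.  Let S_t be the set of vertices at distance at
    most t, in the parity of t, from one of the two classes of a.
    - The map with value 3 on S_1 and a elsewhere is adjacent to the hub, so it
      is coloured 3.  In the same way the map with value 4 on S_1 and a elsewhere
      is coloured 4.
    - A map with value p on S_2 and 3 elsewhere, or 4 elsewhere, is adjacent to
      one of these two, so it is coloured p.  This is used for p = 3, p = 4 and
      for a third low colour p.
    - For each of these p, the map that is p off S_3, a on the part of S_3
      coming from the first class, and a second low colour on the remaining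
      part, is adjacent to the map just coloured p.
    The last three maps are pairwise adjacent, and only two colours are left for
    them ([small_graph_not_colored]). *)

(** * Mod 2 chains of ordered simplices *)

(** A chain with coefficients mod 2 is a list of simplices, and it is only ever
    seen through the cochains that it is paired with. *)
Definition parity (T : Type) (phi : pred (seq T)) (Y : seq (seq T)) :=
  odd (count phi Y).

Fixpoint faces (T : Type) (s : seq T) : seq (seq T) :=
  if s is x :: s' then s' :: map (cons x) (faces s') else [::].

Definition boundary (T : Type) (Y : seq (seq T)) := flatten (map (@faces T) Y).

Definition is_cycle (T : Type) (Y : seq (seq T)) :=
  forall phi, parity phi (boundary Y) = false.

(** The prism x0 .. xi, f xi .. f xn summed over i; written by recursion on the
    simplex so that the boundary formula is proved by induction. *)
Fixpoint prism (T : Type) (f : T -> T) (s : seq T) : seq (seq T) :=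
  if s is x :: s' then (x :: f x :: map f s') :: map (cons x) (prism f s') else [::].

Lemma faces_map (T U : Type) (g : T -> U) s :
  faces (map g s) = map (map g) (faces s).
Proof.
elim: s => [|x s IH] //=; rewrite IH; congr (_ :: _).
by rewrite -!map_comp.
Qed.

Section Chains.
Variable T : Type.
Implicit Types (x : T) (s : seq T) (Y Z : seq (seq T)) (phi psi : pred (seq T)).

Lemma parity_nil phi : parity phi [::] = false. Proof. by []. Qed.

Lemma parity_cons phi s Y : parity phi (s :: Y) = phi s (+) parity phi Y.
Proof. by rewrite /parity /= oddD; case: (phi s). Qed.

Lemma parity_cat phi Y Z : parity phi (Y ++ Z) = parity phi Y (+) parity phi Z.
Proof. by rewrite /parity count_cat oddD. Qed.

Lemma eq_parity phi psi Y : phi =1 psi -> parity phi Y = parity psi Y.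
Proof. by move=> E; rewrite /parity (eq_count E). Qed.

Lemma parity_add phi psi Y :
  parity (fun s => phi s (+) psi s) Y = parity phi Y (+) parity psi Y.
Proof.
elim: Y => [|s Y IH] //; rewrite !parity_cons IH.
by rewrite addbACA.
Qed.

Lemma parity_flatten (g : seq T -> seq (seq T)) phi Y :
  parity phi (flatten (map g Y)) = parity (fun s => parity phi (g s)) Y.
Proof. by elim: Y => [|s Y IH] //=; rewrite parity_cat parity_cons IH. Qed.

Lemma boundary_cons s Y : boundary (s :: Y) = faces s ++ boundary Y. Proof. by []. Qed.

Lemma parity_boundary phi Y :
  parity phi (boundary Y) = parity (fun s => parity phi (faces s)) Y.
Proof. exact: parity_flatten. Qed.

Lemma parity_map (U : Type) (g : seq U -> seq T) phi (Y : seq (seq U)) :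
  parity phi (map g Y) = parity (fun w => phi (g w)) Y.
Proof. by rewrite /parity count_map. Qed.

Lemma parity_faces_cons phi x s :
  parity phi (faces (x :: s)) = phi s (+) parity (fun w => phi (x :: w)) (faces s).
Proof. by rewrite /= parity_cons parity_map. Qed.

(** The chain homotopy formula between the identity and f. *)
Lemma prism_boundary f phi s :
  parity phi (boundary (prism f s)) (+) parity (fun w => parity phi (prism f w)) (faces s)
  = phi s (+) phi (map f s).
Proof.
elim: s phi => [|x s IH] phi; first by rewrite /= !parity_nil addbb.
pose phix w := phi (x :: w).
pose phixf w := phi (x :: f x :: w).
have E1 : parity phi (boundary (map (cons x) (prism f s)))
          = parity phi (prism f s) (+) parity phix (boundary (prism f s)).
  rewrite parity_boundary parity_map (parity_boundary phix) -parity_add.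
  by apply: eq_parity => w; rewrite parity_faces_cons.
have E2 : parity phixf (faces (map f s)) = parity (fun w => phixf (map f w)) (faces s).
  by rewrite faces_map parity_map.
have E3 : parity phi (boundary (prism f (x :: s))) =
   phi (f x :: map f s) (+) phix (map f s) (+) parity phixf (faces (map f s))
   (+) parity phi (prism f s) (+) parity phix (boundary (prism f s)).
  rewrite [prism _ _]/= boundary_cons parity_cat E1 !parity_faces_cons -!addbA.
  by [].
have E4 : parity (fun w => parity phi (prism f w)) (faces (x :: s)) =
   parity phi (prism f s) (+) parity (fun w => phixf (map f w)) (faces s)
   (+) parity (fun w => parity phix (prism f w)) (faces s).
  rewrite parity_faces_cons -addbA -parity_add; congr (_ (+) _).
  by apply: eq_parity => w; rewrite /= parity_cons parity_map.
rewrite E3 E4 E2 /=; have := IH phix.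
set A := parity phix _; set B := parity (fun w => parity phix _) _.
set C := parity phi _; set D := parity (fun w => phixf _) _.
rewrite /phix; set a := phi (x :: s); set b := phi (x :: _); set c := phi (f x :: _).
by case: A; case: B; case: C; case: D; case: a; case: b; case: c.
Qed.

Lemma cycle_map (U : Type) (g : T -> U) Y :
  is_cycle Y -> is_cycle (map (map g) Y).
Proof.
move=> cY f; rewrite /boundary -map_comp.
rewrite (eq_map (g := map (map g) \o @faces T)); last by move=> s; apply: faces_map.
rewrite map_comp -map_flatten -/(boundary Y) /parity count_map.
exact: (cY (f \o map g)).
Qed.

Lemma prism_chain f Y phi : is_cycle Y ->
  parity phi (boundary (flatten (map (prism f) Y))) = parity phi Y (+) parity phi (map (map f) Y).
Proof.
move=> cY; have := cY (fun w => parity phi (prism f w)).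
rewrite parity_boundary /boundary map_flatten -map_comp.
have -> : parity phi (flatten (flatten [seq ([eta map (@faces T)] \o prism f) i | i <- Y])) =
          parity (fun s => parity phi (boundary (prism f s))) Y.
  by elim: (Y) => [|s Z IH] //=; rewrite flatten_cat parity_cat IH -/(boundary _) parity_cons.
rewrite parity_map -parity_add => eq0.
rewrite -[LHS]addbF -eq0 -parity_add; apply: eq_parity => s.
exact: prism_boundary.
Qed.

Definition cone x Y := map (cons x) Y.

Lemma cone_boundary x phi Y :
  is_cycle Y -> parity phi (boundary (cone x Y)) = parity phi Y.
Proof.
move=> cY; have := cY (fun w => phi (x :: w)).
rewrite !parity_boundary /cone parity_map => eq0; rewrite -[RHS]addbF -eq0 -parity_add.
by apply: eq_parity => w; rewrite parity_faces_cons.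
Qed.

End Chains.

(** A prism over a simplex uses only old vertices and their images, so it lies
    in the complex as soon as the old and moved vertices fit together. *)
Lemma prism_sub (T : eqType) (f : T -> T) s w :
  w \in prism f s -> size w = (size s).+1 /\ {subset w <= s ++ map f s}.
Proof.
elim: s w => [|x s IH] w //=; rewrite inE => /orP[/eqP->|].
  split=> [|y]; first by rewrite /= size_map.
  by rewrite !inE mem_cat inE => /or3P[] ->; rewrite ?orbT.
case/mapP => v /IH[sz sub] ->; split=> [|y]; first by rewrite /= sz.
rewrite !inE mem_cat inE => /orP[->//|/sub]; rewrite mem_cat.
by case/orP=> ->; rewrite ?orbT.
Qed.

(** * Counting alternating simplices *)

Fixpoint alternates (b : bool) (l : seq nat) : bool :=
  if l is x :: l' then (odd x == b) && alternates (~~ b) l' else true.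

(** If the signs of l alternate, dropping an end leaves an alternating list
    starting with either sign.  If they do not, the alternating faces come in
    pairs: either of two neighbours with equal signs can be dropped. *)
Lemma alternates_faces b l :
  parity (alternates b) (faces l) = alternates b l (+) alternates (~~ b) l.
Proof.
elim: l b => [|x l IH] b; first by rewrite parity_nil.
rewrite parity_faces_cons [alternates b (x :: l)]/= [alternates (~~ b) (x :: l)]/= negbK.
case: eqVneq => [E | neq].
  rewrite (eq_parity _ (psi := alternates (~~ b))) => [|w]; last by rewrite /= E eqxx.
  rewrite IH negbK E {E IH}.
  by case: b; case: (alternates true l); case: (alternates false l).
rewrite (eq_parity _ (psi := xpred0)) => [|w]; last by rewrite /= (negbTE neq).
rewrite /parity count_pred0 addbF.
by case: (odd x) b neq => [] [] //; case: (alternates _ l).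
Qed.

Lemma count_faces (T : eqType) (phi : pred (seq T)) l :
  (forall l1 l2, perm_eq l1 l2 -> phi l1 = phi l2) ->
  count phi (faces l) = count (fun x => phi (rem x l)) l.
Proof.
elim: l phi => [|x l IH] phi phiP //=.
rewrite eqxx count_map; congr (_ + _).
rewrite IH; last by move=> l1 l2 p12; apply: phiP; rewrite perm_cons.
apply: eq_in_count => y yl /=; case: eqVneq => [->|//].
by apply: phiP; rewrite perm_sym perm_to_rem.
Qed.

Lemma count_faces_perm (T : eqType) (phi : pred (seq T)) l1 l2 :
  (forall l l', perm_eq l l' -> phi l = phi l') ->
  perm_eq l1 l2 -> count phi (faces l1) = count phi (faces l2).
Proof.
move=> phiP p12; rewrite !count_faces // (permP p12).
apply: eq_in_count => x x2; apply: phiP; rewrite -(perm_cons x).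
apply: perm_trans (perm_to_rem x2); rewrite perm_sym.
by apply: perm_trans (perm_to_rem _); rewrite 1?perm_sym ?(perm_mem p12).
Qed.

Lemma faces_subseq (T : eqType) (l f : seq T) : f \in faces l -> subseq f l.
Proof.
elim: l f => [|x l IH] f //=; rewrite inE => /orP[/eqP->|].
  exact: subseq_cons.
by case/mapP => g /IH gl ->; rewrite /= eqxx.
Qed.

(** A label is a natural number coding a colour, its half, and a sign, its
    parity; sorting labels sorts the colours. *)
Definition fan b (l : seq nat) := alternates b (sort leq l).

Lemma fan_perm b l1 l2 : perm_eq l1 l2 -> fan b l1 = fan b l2.
Proof.
move=> p; rewrite /fan; congr alternates.
by apply/perm_sortP => //; [apply: leq_total | apply: leq_trans | apply: anti_leq].
Qed.

(** Ky Fan's relation.  Sorting is harmless because the faces of a permuted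
    list are the permuted faces. *)
Lemma fan_faces b l : parity (fan b) (faces l) = fan b l (+) fan (~~ b) l.
Proof.
rewrite /fan -alternates_faces /parity.
rewrite (count_faces_perm (l2 := sort leq l)).
- congr (odd _); apply: eq_in_count => f /faces_subseq fl; rewrite /=.
  rewrite sorted_sort //; first exact: leq_trans.
  by apply: subseq_sorted fl _; [apply: leq_trans | apply: sort_sorted; apply: leq_total].
- exact: fan_perm.
- by rewrite perm_sym perm_sort.
Qed.

(** No colour occurs with both signs: this is what a proper colouring gives on
    a simplex. *)
Definition unpaired (l : seq nat) :=
  forall x y, x \in l -> y \in l -> x./2 = y./2 -> x = y.

(** The label with the same colour and the opposite sign. *)
Definition flip x := (~~ odd x) + x./2.*2.

Lemma odd_flip x : odd (flip x) = ~~ odd x.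
Proof. by rewrite /flip oddD odd_double addbF oddb. Qed.

Lemma alternates_flip b l : alternates b (map flip l) = alternates (~~ b) l.
Proof.
by elim: l b => [|x l IH] b //=; rewrite IH odd_flip; case: (odd x) b => [] [].
Qed.

Lemma fan_flip b l : unpaired l -> fan b (map flip l) = fan (~~ b) l.
Proof.
move=> un; rewrite /fan -alternates_flip; congr alternates.
apply: (sorted_eq leq_trans anti_leq); first exact: (sort_sorted leq_total).
  have srt := sort_sorted leq_total l.
  rewrite sorted_map; apply: (sub_in_sorted (P := [in l]) _ _ srt); last first.
    by apply/allP => x; rewrite mem_sort.
  move=> x y xl yl; rewrite /relpre /= leq_eqVlt => /orP[/eqP->//|ltxy].
  have [E|neq] := eqVneq x./2 y./2; first by rewrite (un x y).
  have: x./2 < y./2 by rewrite ltn_neqAle neq /=; apply/half_leq/ltnW.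
  move=> lth; rewrite /flip; apply: (@leq_trans (x./2.+1.*2)).
    by rewrite doubleS -add2n leq_add2r; case: (odd x).
  by apply: leq_trans (leq_addl _ _); rewrite leq_double.
by rewrite perm_sort; apply: perm_map; rewrite perm_sym perm_sort.
Qed.

(** Consecutive labels of opposite signs have different colours, so the sorted
    colours increase strictly. *)
Lemma alternation_bound b m l :
  unpaired l -> all (fun x => x./2 < m) l -> fan b l -> size l <= m.
Proof.
move=> un lm alt; rewrite -(size_sort leq) -(size_map half) -(size_iota 0 m).
have srt := sort_sorted leq_total l.
have in_l : all [in l] (sort leq l) by apply/allP => x; rewrite mem_sort.
have: sorted ltn (map half (sort leq l)).
  move: alt srt in_l; rewrite /fan; move: (sort leq l) => s.
  elim: s b => [|x [|y s] IH] b //= /and3P[/eqP xb /eqP yb alt] /andP[xy srt].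
  move=> /and3P[xl yl sl]; apply/andP; split; last first.
    by apply: (IH (~~ b)) => //=; [rewrite yb eqxx | rewrite yl].
  have neq : x./2 != y./2.
    by apply/eqP => /(un x y xl yl) E; move: yb; rewrite -E xb; case: (b).
  by rewrite ltn_neqAle neq /=; apply: half_leq.
move=> lts; apply: uniq_leq_size; first exact: (sorted_uniq ltn_trans ltnn).
move=> c /mapP[x]; rewrite mem_sort => xl ->.
by rewrite mem_iota add0n; apply: (allP lm).
Qed.

(** * Signed words and moves of cycles *)

(** A vertex x of the graph together with a sign is coded by one word over the
    letters 0 .. 9.  The letter p stands for min p (9 - p), and the sign is the
    parity of p; all letters of a word share it.  Adjacent vertices with
    opposite signs become words whose corresponding letters differ by one, and
    changing the sign is p |-> 9 - p. *)
Definition near p q := (p.+1 == q) || (q.+1 == p).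
Definition sign (w : seq nat) := odd (head 0 w).
Definition signed_word k (w : seq nat) :=
  [&& size w == k, all (fun p => (p <= 9) && (odd p == sign w)) w,
      count_mem (if sign w then 9 else 0) w == 1
    & (if sign w then 1 else 8) \in w].
Definition compat w w' := (sign w == sign w') || all2 near w w'.
Definition chain n (P : pred (seq nat)) (Y : seq (seq (seq nat))) :=
  all (fun s => [&& size s == n, all P s & all2rel compat s]) Y.
(** [n] is the number of vertices of the simplices of [Y], and [k] the length of
    the words of the filling. *)
Definition bounds n k Y :=
  exists Z, chain n.+1 (signed_word k) Z /\ (forall phi, parity phi (boundary Z) = parity phi Y).

Lemma nearP p q : reflect (p.+1 = q \/ q.+1 = p) (near p q).
Proof. by apply: (iffP orP) => -[] /eqP ?; [left|right|left|right]. Qed.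

Lemma all2_near_sym u v : all2 near u v = all2 near v u.
Proof. by elim: u v => [|p u IH] [|q v] //=; rewrite IH /near orbC. Qed.

Lemma compat_sym w w' : compat w w' = compat w' w.
Proof. by rewrite /compat all2_near_sym eq_sym. Qed.

Lemma chainP n (P : pred (seq nat)) Y :
  reflect (forall s, s \in Y -> [/\ size s = n, {in s, forall w, P w} &
     {in s &, forall w w', compat w w'}]) (chain n P Y).
Proof.
apply: (iffP allP) => [cY s /cY /and3P[/eqP sz /allP Ps /allrelP cs] | cY s /cY[sz Ps cs]].
  by split.
by apply/and3P; split; [apply/eqP | apply/allP | apply/allrelP].
Qed.

(** Moving vertices along f changes a cycle by the boundary of prisms.  The
    hypotheses put these prisms into the complex: moved words have to remain
    near the words of opposite sign, moved or not. *)
Lemma move_chain n k (P Q : pred (seq nat)) f Y :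
  subpred P (signed_word k) -> subpred Q (signed_word k) ->
  (forall w, P w -> Q (f w) && (sign (f w) == sign w)) ->
  (forall w w', P w -> P w' -> all2 near w w' ->
     all2 near (f w) w' && all2 near (f w) (f w')) ->
  chain n P Y -> is_cycle Y ->
  (chain n Q (map (map f) Y) -> is_cycle (map (map f) Y) ->
     bounds n k (map (map f) Y)) ->
  bounds n k Y.
Proof.
move=> Pg Qg fP fN /chainP cY zY rec.
have sgf w : P w -> sign (f w) = sign w by move/fP/andP=> [_ /eqP].
have cP w w' : P w -> P w' -> compat w w' -> compat (f w) w' && compat (f w) (f w').
  move=> Pw Pw'; rewrite /compat !sgf //; case: (sign w == sign w') => //= nww.
  exact: fN.
have chQ : chain n Q (map (map f) Y).
  apply/chainP => _ /mapP[s /cY[sz Ps cs] ->]; split.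
  - by rewrite size_map.
  - by move=> _ /mapP[w /Ps /fP/andP[Qw _] ->].
  - move=> _ _ /mapP[w ws ->] /mapP[w' ws' ->].
    by case/andP: (cP _ _ (Ps _ ws) (Ps _ ws') (cs _ _ ws ws')).
have [Z [chZ dZ]] := rec chQ (@cycle_map _ _ f Y zY).
exists (flatten (map (prism f) Y) ++ Z); split.
  rewrite /chain all_cat -!/(chain _ _ _) chZ andbT; apply/chainP => s.
  case/flatten_mapP => t /cY[sz Pt ct] /prism_sub[sz' sub]; split.
  - by rewrite sz' sz.
  - move=> w /sub; rewrite mem_cat => /orP[/Pt/Pg //|/mapP[v /Pt/fP/andP[Qv _] ->]].
    exact: Qg.
  - move=> w w' /sub wt /sub wt'; move: wt wt'; rewrite !mem_cat.
    have cf v v' : v \in t -> v' \in t -> compat (f v) v' && compat (f v) (f v').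
      by move=> vt vt'; apply: cP; rewrite ?Pt ?ct.
    case/orP=> [wt|/mapP[v vt ->]] /orP[wt'|/mapP[v' vt' ->]].
    + exact: ct.
    + by rewrite compat_sym; case/andP: (cf _ _ vt' wt).
    + by case/andP: (cf _ _ vt wt').
    + by case/andP: (cf _ _ vt vt').
move=> phi; rewrite /boundary map_cat flatten_cat parity_cat -!/(boundary _) prism_chain // dZ.
by rewrite -addbA addbb addbF.
Qed.

(** The words that come from the equator: a word of length [k] behind a first
    letter that depends on the sign only, [a] for even and [b] for odd words. *)
Definition prefixed k a b (w : seq nat) :=
  if w is c :: u then signed_word k u && (c == if sign u then b else a) else false.

Definition rehead a b (w : seq nat) := (if sign (behead w) then b else a) :: behead w.

Lemma prefixed_signed k a b : 0 < a < 9 -> ~~ odd a -> 0 < b < 9 -> odd b ->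
  subpred (prefixed k a b) (signed_word k.+1).
Proof.
move=> ha ea hb ob [|c u] //= /andP[/and4P[/eqP sz al ct hs] /eqP ->].
have sgc : sign ((if sign u then b else a) :: u) = sign u.
  by rewrite /sign /= -/(sign u); case: (sign u) => //; apply/negbTE.
rewrite /signed_word sgc /= sz eqxx in_cons hs orbT andbT.
rewrite al andbT; move: ct; case: (sign u); rewrite /= ?ob ?(negbTE ea) => /eqP ->; lia.
Qed.

Lemma prefixed_move n k a b a' b' Y :
  0 < a < 9 -> ~~ odd a -> 0 < b < 9 -> odd b ->
  0 < a' < 9 -> ~~ odd a' -> 0 < b' < 9 -> odd b' ->
  near a b -> near a b' -> near a' b -> near a' b' ->
  chain n (prefixed k a b) Y -> is_cycle Y ->
  (forall Y', chain n (prefixed k a' b') Y' -> is_cycle Y' -> bounds n k.+1 Y') ->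
  bounds n k.+1 Y.
Proof.
move=> ha ea hb ob ha' ea' hb' ob' nab nab' na'b na'b' cY zY rec.
apply: (move_chain (f := rehead a' b') _ _ _ _ cY zY _) => //.
- exact: prefixed_signed.
- exact: (prefixed_signed ha' ea' hb' ob').
- case=> [|c u] // /andP[gu /eqP cE]; rewrite /rehead /= gu eqxx /= /sign /= cE.
  by rewrite -/(sign u); case: (sign u); rewrite /= ?(negbTE ea) ?(negbTE ea') ?ob ?ob'.
- case=> [|c u] // [|c' u'] // /andP[gu /eqP ->] /andP[gu' /eqP ->] /=.
  case/andP; case: (sign u); case: (sign u') => /= ncc' ->; rewrite ?andbT.
  + by move: ncc'; rewrite /near; lia.
  + by rewrite ![near b' _]orbC -!/(near _ _) nab' na'b'.
  + by rewrite na'b na'b'.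
  + by move: ncc'; rewrite /near; lia.
- exact: rec.
Qed.

(** Words close to the pole: the first letter is 0 or 1, so that the extreme
    letter 0 of even words and the letter 1 of odd words are provided by it and
    the other letters need only be at least [m]. *)
Definition capped k m (w : seq nat) :=
  if w is c :: u then
    [&& size u == k, all (fun p => (m <= p <= 9) && (odd p == odd c)) u,
        c == odd c, (if odd c then count_mem 9 u == 1 else true)
      & (if odd c then true else 8 \in u)]
  else false.

Lemma capped_signed k m : 0 < m -> subpred (capped k m) (signed_word k.+1).
Proof.
move=> m0 [|c u] // /and5P[/eqP sz al /eqP cE ct hs].
rewrite /signed_word /sign /= sz eqxx /=; move: al ct hs; rewrite cE.
case: (odd c) => /= al ct hs.
  rewrite (eqP ct) in_cons eqxx !andbT.
  by apply: sub_all al => p /andP[/andP[_ ->]].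
rewrite in_cons hs orbT andbT (_ : count_mem 0 u = 0) ?andbT.
  by apply: sub_all al => p /andP[/andP[_ ->]].
by apply/count_memPn/negP => /(allP al) /andP[/andP[m_le0 _] _]; lia.
Qed.

(** Folding the path 0 - 1 - .. - 9 at its end: once no letter is below [m],
    the only neighbour of [m] is [m.+1], which is also near [m.+2]. *)
Definition push m p := if p == m then m.+2 else p.

Lemma near_push m u v : all (leq m) u -> all (leq m) v -> all2 near u v ->
  all2 near (map (push m) u) v && all2 near (map (push m) u) (map (push m) v).
Proof.
elim: u v => [|p u IH] [|q v] //= /andP[mp mu] /andP[mq mv] /andP[npq nuv].
have /andP[-> ->] := IH _ mu mv nuv; rewrite !andbT.
move/nearP: npq mp mq => npq mp mq.
by apply/andP; split; apply/nearP; rewrite /push; do ![case: eqP => ?]; lia.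
Qed.

Definition push_tail m (w : seq nat) := head 0 w :: map (push m) (behead w).

Lemma capped_move n k m Y : 0 < m <= 5 ->
  chain n (capped k m) Y -> is_cycle Y ->
  (forall Y', chain n (capped k m.+1) Y' -> is_cycle Y' -> bounds n k.+1 Y') ->
  bounds n k.+1 Y.
Proof.
move=> hm cY zY rec.
apply: (move_chain (f := push_tail m) _ _ _ _ cY zY _) => //.
- by apply: capped_signed; lia.
- by apply: (@capped_signed _ m.+1).
- case=> [|c u] // /and5P[/eqP sz al /eqP cE ct hs]; rewrite /push_tail /= size_map sz eqxx /=.
  rewrite -cE eqxx /sign /= eqxx andbT; apply/and3P; split.
  + rewrite all_map; apply: sub_all al => p /andP[/andP[mp p9] /eqP pc] /=.
    rewrite /push -pc; case: (p =P m) => [->|?]; rewrite /= ?negbK ?eqxx ?andbT; lia.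
  + case: (odd c) ct => //; rewrite count_map => ct.
    rewrite (eq_count (a2 := pred1 9)) // => p /=.
    by rewrite /push; case: (p =P m) => [->|_]; first lia.
  + case: (odd c) hs => // hs; apply/mapP; exists 8 => //.
    by rewrite /push; case: eqP => //; lia.
- case=> [|c u] // [|c' u'] // /and5P[_ al _ _ _] /and5P[_ al' _ _ _] /=.
  case/andP=> -> nuu' /=; apply: near_push nuu'.
    by apply: sub_all al => p /andP[/andP[]].
  by apply: sub_all al' => p /andP[/andP[]].
- exact: rec.
Qed.

(** Even words give up the letter 0 behind the first place at the moment when
    their first letter becomes 0, so that exactly one letter 0 remains. *)
Lemma prefixed_capped_move n k Y :
  chain n (prefixed k 2 1) Y -> is_cycle Y ->
  (forall Y', chain n (capped k 1) Y' -> is_cycle Y' -> bounds n k.+1 Y') ->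
  bounds n k.+1 Y.
Proof.
move=> cY zY rec.
pose f w := (if odd (head 0 w) then 1 else 0) :: map (push 0) (behead w).
apply: (move_chain (f := f) _ _ _ _ cY zY _) => //.
- exact: prefixed_signed.
- exact: (@capped_signed k 1).
- case=> [|c u] // /andP[/and4P[/eqP sz al ct hs] /eqP ->].
  rewrite /f /= size_map sz eqxx /= /sign /= -/(sign u).
  case: (sign u) al ct hs => /= al ct hs; rewrite ?andbT.
  + apply/andP; split.
      rewrite all_map; apply: sub_all al => p /= /andP[p9 op].
      rewrite /push; case: (p =P 0) op => [->|?] op; rewrite /= ?op ?eqxx ?andbT; lia.
    rewrite count_map (eq_count (a2 := pred1 9)) // => p /=.
    by rewrite /push; case: (p =P 0) => [->|_].
  + apply/andP; split.
      rewrite all_map; apply: sub_all al => p /= /andP[p9 op].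
      rewrite /push; case: (p =P 0) op => [->|?] op; rewrite /= ?op ?eqxx ?andbT; lia.
    by apply/mapP; exists 8.
- case=> [|c u] // [|c' u'] // /andP[gu /eqP ->] /andP[gu' /eqP ->].
  rewrite /f /= => /andP[ncc nuu].
  have /andP[-> ->] : all2 near (map (push 0) u) u' &&
     all2 near (map (push 0) u) (map (push 0) u').
    by apply: near_push nuu; apply/allP.
  by move: ncc; case: (sign u); case: (sign u').
- exact: rec.
Qed.

(** When odd words have only 7 and 9 behind the first letter, they are all near
    the even word 0 8 .. 8, which serves as apex. *)
Lemma capped_cone n k Y :
  0 < k -> chain n (capped k 6) Y -> is_cycle Y -> bounds n k.+1 Y.
Proof.
move=> k0 /chainP cY zY; exists (cone (0 :: nseq k 8) Y); split; last first.
  by move=> phi; apply: cone_boundary.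
pose p := 0 :: nseq k 8.
have gp : signed_word k.+1 p.
  rewrite /signed_word /p /sign /= size_nseq eqxx /= all_nseq /= orbT count_nseq /=.
  by rewrite in_cons mem_nseq k0.
have cpw w : capped k 6 w -> compat p w.
  case: w => [|c u] // /and5P[/eqP sz al /eqP cE _ _].
  rewrite /compat /p /sign /=; move: al; rewrite cE; case: (odd c) => //= al.
  elim: u k {k0 cY gp p} sz al => [|q u IH] [|k] //= [sz] /andP[hq al].
  by rewrite (IH k) // andbT; move: hq; rewrite /near; lia.
apply/chainP => _ /mapP[s /cY[sz Ps cs] ->]; split.
- by rewrite /= sz.
- by move=> w; rewrite inE => /orP[/eqP->//|/Ps]; apply: capped_signed.
- move=> w w'; rewrite !inE => /orP[/eqP->|ws] /orP[/eqP->|ws'].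
  + by rewrite /compat eqxx.
  + by apply: cpw; apply: Ps.
  + by rewrite compat_sym; apply: cpw; apply: Ps.
  + exact: cs.
Qed.

(** The first letters travel from (4, 5) to (2, 1), then the pole is reached and
    the other letters are folded five times. *)
Lemma equator_bounds n k Y :
  0 < k -> chain n (prefixed k 4 5) Y -> is_cycle Y -> bounds n k.+1 Y.
Proof.
move=> k0 cY zY.
apply: (prefixed_move (a' := 4) (b' := 3) _ _ _ _ _ _ _ _ _ _ _ _ cY zY) => // {cY zY} Y cY zY.
apply: (prefixed_move (a' := 2) (b' := 3) _ _ _ _ _ _ _ _ _ _ _ _ cY zY) => // {cY zY} Y cY zY.
apply: (prefixed_move (a' := 2) (b' := 1) _ _ _ _ _ _ _ _ _ _ _ _ cY zY) => // {cY zY} Y cY zY.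
apply: (prefixed_capped_move cY zY) => {cY zY} Y cY zY.
do 5 (apply: (capped_move _ cY zY) => // {cY zY} Y cY zY).
exact: capped_cone cY zY.
Qed.

(** * The chromatic number of the graph of wide words *)

(** Two letters can face each other in adjacent vertices if they differ by one,
    or if both are 4: at distance at least 4 from a class the parity of the
    distance is forgotten. *)
Definition step p q := near p q || ((p == 4) && (q == 4)).
Definition wide_adj := all2 step.
(** A vertex lies in exactly one colour class and is next to another one. *)
Definition wide_word k (x : seq nat) :=
  [&& size x == k, all (leq^~ 4) x, count_mem 0 x == 1 & 1 \in x].

Definition unsigned_letter p := minn p (9 - p).
Definition unsigned := map unsigned_letter.
Definition antipode := map (subn 9).

Lemma signed_word_cons k w : signed_word k w -> exists c u, w = c :: u.
Proof. by case: w => [|c u] gw; [case/and4P: gw | exists c, u]. Qed.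

Lemma signed_word_letter k w p :
  signed_word k w -> p \in w -> (p <= 9) && (odd p == sign w).
Proof. by case/and4P=> _ /allP al _ _ /al. Qed.

Lemma unsigned_wide k w : signed_word k w -> wide_word k (unsigned w).
Proof.
case/and4P=> sz al ct hs; rewrite /wide_word size_map sz all_map /=.
apply/and3P; split.
- by apply/allP => p _ /=; rewrite /unsigned_letter; lia.
- rewrite count_map -(eqnP ct); apply/eqP/eq_in_count => p pw /=.
  have := allP al p pw => /andP[p9 /eqP]; rewrite /unsigned_letter.
  case: (sign w) => op; apply/eqP/eqP; lia.
- by apply/mapP; move: hs; case: (sign w) => hs; [exists 1 | exists 8].
Qed.

Lemma unsigned_adj k w w' : signed_word k w -> signed_word k w' -> all2 near w w' ->
  wide_adj (unsigned w) (unsigned w').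
Proof.
move=> gw gw'; have: all (leq^~ 9) w by apply/allP => p /(signed_word_letter gw)/andP[].
have: all (leq^~ 9) w' by apply/allP => p /(signed_word_letter gw')/andP[].
rewrite /wide_adj; elim: w w' {gw gw'} => [|p w IH] [|q w'] //= /andP[q9 al'] /andP[p9 al].
case/andP=> /nearP npq nw; rewrite IH // andbT /step /unsigned_letter.
have [E|[E|[-> ->]]] : (minn p (9 - p)).+1 = minn q (9 - q) \/ (minn q (9 - q)).+1 = minn p (9 - p)
   \/ (minn p (9 - p) = 4 /\ minn q (9 - q) = 4) by lia.
- by apply/orP; left; apply/nearP; left.
- by apply/orP; left; apply/nearP; right.
by [].
Qed.

Definition wide_coloring k m (c : seq nat -> nat) :=
  (forall x, wide_word k x -> c x < m) /\
  (forall x y, wide_word k x -> wide_word k y -> wide_adj x y -> c x != c y).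

Definition label (c : seq nat -> nat) w := sign w + (c (unsigned w)).*2.

Lemma half_label c w : (label c w)./2 = c (unsigned w).
Proof. exact: half_bit_double. Qed.

Lemma odd_label c w : odd (label c w) = sign w.
Proof. by rewrite /label oddD odd_double addbF oddb. Qed.

Lemma unpaired_label k m c s :
  wide_coloring k m c -> all (signed_word k) s -> all2rel compat s ->
  unpaired (map (label c) s).
Proof.
move=> [_ cP] /allP gs /allrelP cs _ _ /mapP[w ws ->] /mapP[w' ws' ->].
rewrite !half_label /label => E; have := cs _ _ ws ws'; rewrite /compat.
case/orP => [/eqP -> | nww]; first by rewrite E.
have [gw gw'] := (gs _ ws, gs _ ws').
have := cP _ _ (unsigned_wide gw) (unsigned_wide gw') (unsigned_adj gw gw' nww).
by rewrite E eqxx.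
Qed.

Lemma antipode_signed k w : signed_word k w ->
  [/\ signed_word k (antipode w), sign (antipode w) = ~~ sign w,
   unsigned (antipode w) = unsigned w & antipode (antipode w) = w].
Proof.
move=> gw; have le9 := signed_word_letter gw.
have sgN : sign (antipode w) = ~~ sign w.
  have [c [u E]] := signed_word_cons gw; have := le9 c; rewrite E mem_head /sign /=.
  by case/(_ isT)/andP=> c9 _; rewrite oddB.
split=> //.
- case/and4P: gw => sz al ct hs; rewrite /signed_word sgN size_map sz /=; apply/and3P; split.
  + rewrite all_map; apply/allP => p /le9/andP[p9 /eqP <-] /=.
    by rewrite leq_subr oddB //= eqxx.
  + rewrite count_map (eq_in_count (a2 := pred1 (if sign w then 9 else 0))) // => p /le9/andP[p9 _] /=.
    by case: (sign w) => /=; apply/eqP/eqP; lia.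
  + by apply/mapP; move: hs; case: (sign w) => /= hs; [exists 1 | exists 8].
- rewrite /unsigned /antipode -map_comp; apply/eq_in_map => p /le9/andP[p9 _] /=.
  by rewrite /unsigned_letter; lia.
- rewrite /antipode -map_comp -[RHS]map_id; apply/eq_in_map => p /le9/andP[p9 _] /=; lia.
Qed.

Lemma label_antipode k c w : signed_word k w -> label c (antipode w) = flip (label c w).
Proof.
by case/antipode_signed=> _ sgN shN _; rewrite /flip odd_label half_label /label sgN shN.
Qed.

Lemma antipode_compat k w w' : signed_word k w -> signed_word k w' ->
  compat w w' -> compat (antipode w) (antipode w').
Proof.
move=> gw gw'; have [_ sN _ _] := antipode_signed gw; have [_ sN' _ _] := antipode_signed gw'.
rewrite /compat sN sN' (inj_eq negb_inj); case: (sign w == sign w') => //=.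
have: all (leq^~ 9) w by apply/allP => p /(signed_word_letter gw)/andP[].
have: all (leq^~ 9) w' by apply/allP => p /(signed_word_letter gw')/andP[].
elim: w w' {gw gw' sN sN'} => [|p w IH] [|q w'] //= /andP[q9 al'] /andP[p9 al].
case/andP=> /nearP npq nw; rewrite IH // andbT; apply/nearP; lia.
Qed.

(** The letters 4 and 5 both stand for the unsigned letter 4. *)
Definition equator w := (4 + sign w) :: w.

Lemma sign_equator w : sign (equator w) = sign w.
Proof. by rewrite {1}/sign /=; case: (sign w). Qed.

Lemma unsigned_equator w : unsigned (equator w) = 4 :: unsigned w.
Proof. by rewrite /unsigned /=; case: (sign w). Qed.

Lemma antipode_equator k w :
  signed_word k w -> antipode (equator w) = equator (antipode w).
Proof. by case/antipode_signed=> _ sN _ _; rewrite /equator sN /antipode /=; case: (sign w). Qed.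

Lemma equator_prefixed k w : signed_word k w -> prefixed k 4 5 (equator w).
Proof. by move=> gw; rewrite /= gw; case: (sign w). Qed.

Lemma equator_compat w w' : compat w w' -> compat (equator w) (equator w').
Proof.
rewrite /compat !sign_equator; case: eqP => //= neq ->; rewrite andbT.
by move: neq; case: (sign w); case: (sign w').
Qed.

Lemma label_equator c w : label c (equator w) = label (fun x => c (4 :: x)) w.
Proof. by rewrite /label sign_equator unsigned_equator. Qed.

Lemma equator_coloring k m c :
  wide_coloring k.+1 m c -> wide_coloring k m (fun x => c (4 :: x)).
Proof.
have wl x : wide_word k x -> wide_word k.+1 (4 :: x).
  by case/and4P=> sz al ct hs; rewrite /wide_word /= eqSS sz al ct in_cons hs.
by case=> cm cP; split=> [x /wl/cm|x y /wl wx /wl wy axy] //; apply: cP.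
Qed.

Definition fan_coloring c b s := fan b (map (label c) s).

Lemma fan_antipode k m c b s :
  wide_coloring k m c -> all (signed_word k) s -> all2rel compat s ->
  fan_coloring c b (map antipode s) = fan_coloring c (~~ b) s.
move=> cP gs cs; rewrite /fan_coloring -fan_flip; last exact: unpaired_label cP gs cs.
rewrite -!map_comp; congr fan; apply/eq_in_map => w ws /=.
by apply: label_antipode; apply: (allP gs).
Qed.

Lemma fan_coloring_faces c b s :
  parity (fan_coloring c b) (faces s) =
  fan_coloring c b s (+) fan_coloring c (~~ b) s.
Proof. by rewrite /fan_coloring -fan_faces faces_map /parity count_map. Qed.

(** The symmetric cycle z + antipode z is the sphere, with z as one hemisphere;
    the last condition says that it has an odd number of alternating simplices
    starting with a given sign, for every proper colouring. *)
Definition odd_sphere k z :=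
  [/\ chain k (signed_word k) z, is_cycle (z ++ map (map antipode) z) &
    forall c m, wide_coloring k m c ->
      parity (fan_coloring c false) z (+) parity (fan_coloring c true) z].

Lemma chain_map n (P Q : pred (seq nat)) g z :
  (forall w, P w -> Q (g w)) ->
  (forall w w', P w -> P w' -> compat w w' -> compat (g w) (g w')) ->
  chain n P z -> chain n Q (map (map g) z).
Proof.
move=> gP gC /chainP cz; apply/chainP => _ /mapP[s /cz[sz Ps cs] ->]; split.
- by rewrite size_map.
- by move=> _ /mapP[w /Ps/gP Qw ->].
- move=> _ _ /mapP[w ws ->] /mapP[w' ws' ->].
  by apply: gC; rewrite ?Ps ?cs.
Qed.

(** Words of length 2 form a single edge, whose sphere is a circle. *)
Lemma odd_sphere_base : odd_sphere 2 [:: [:: [:: 0; 8]; [:: 1; 9]]; [:: [:: 1; 9]; [:: 9; 1]]].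
Proof.
split=> // [phi|c m cP].
  rewrite /parity /boundary /=.
  by case: (phi [:: [:: 1; 9]]); case: (phi [:: [:: 0; 8]]); case: (phi [:: [:: 9; 1]]);
     case: (phi [:: [:: 8; 0]]).
set z := (z in parity _ z); rewrite -parity_add.
rewrite (eq_parity (psi := fun s => parity (fan_coloring c false) (faces s))); last first.
  by move=> s; rewrite fan_coloring_faces.
rewrite -parity_boundary /z /parity /boundary /= /fan_coloring /=.
by rewrite !addn0 /fan /= !andbT !add0n /label !oddD !odd_double !addbF.
Qed.

(** The filling of the equator is the new hemisphere.  Its alternating simplices
    are counted on its boundary by Fan's relation, and there they are those of
    the old sphere, for the colouring restricted to the words starting
    with 4. *)
Lemma odd_sphere_step k z : 0 < k -> odd_sphere k z -> exists z', odd_sphere k.+1 z'.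
Proof.
move=> k0 [cz zz oz]; pose Y := z ++ map (map antipode) z.
have gz s : s \in z -> all (signed_word k) s by move/(allP cz)/and3P=> [].
have coz s : s \in z -> all2rel compat s by move/(allP cz)/and3P=> [].
have cnz : chain k (signed_word k) (map (map antipode) z).
  apply: chain_map cz; first by move=> w /antipode_signed[].
  exact: antipode_compat.
have cY : chain k (prefixed k 4 5) (map (map equator) Y).
  apply: (chain_map (P := signed_word k)); first exact: equator_prefixed.
    by move=> w w' _ _; apply: equator_compat.
  by rewrite /chain /Y all_cat -!/(chain _ _ _) cz.
have [Z [cZ dZ]] := equator_bounds k0 cY (@cycle_map _ _ equator Y zz).
have parityY phi : parity phi (map (map equator) Y) =
    parity (fun s => phi (map equator s)) z (+) parity (fun s => phi (map equator (map antipode s))) z.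
  by rewrite /Y map_cat parity_cat /parity !count_map.
exists Z; split=> [//|phi|c m cP].
  rewrite /boundary map_cat flatten_cat parity_cat -!/(boundary _) dZ.
  have -> : parity phi (boundary (map (map antipode) Z)) = parity (phi \o map antipode) (boundary Z).
    rewrite !parity_boundary /parity count_map; congr (odd _); apply: eq_count => s /=.
    by rewrite faces_map /parity count_map.
  (* The equator is invariant under the antipode, which swaps its two halves. *)
  rewrite dZ !parityY addbC addbACA; apply/eqP; rewrite addbC; apply/eqP.
  have E1 : parity (fun s => (phi \o map antipode) (map equator s)) z
          = parity (fun s => phi (map equator (map antipode s))) z.
    congr (odd _); apply: eq_in_count => s /gz/allP gs /=; congr phi.
    by rewrite -!map_comp; apply/eq_in_map => w /gs gw; apply: antipode_equator gw.
  have E2 : parity (fun s => (phi \o map antipode) (map equator (map antipode s))) z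
          = parity (fun s => phi (map equator s)) z.
    congr (odd _); apply: eq_in_count => s /gz/allP gs /=; congr phi.
    rewrite -!map_comp; apply/eq_in_map => w /gs gw.
    by have [gw' _ _ nn] := antipode_signed gw; apply: etrans (antipode_equator gw') (congr1 equator nn).
  rewrite E1 E2.
  by case: (parity _ z); case: (parity _ z).
rewrite -parity_add (eq_parity (psi := fun s => parity (fan_coloring c false) (faces s))); last first.
  by move=> s; rewrite fan_coloring_faces.
rewrite -parity_boundary dZ parityY.
pose c' x := c (4 :: x); have cP' : wide_coloring k m c' := equator_coloring cP.
have TL b s : fan_coloring c b (map equator s) = fan_coloring c' b s.
  by rewrite /fan_coloring -map_comp; congr fan; apply: eq_map => w /=; rewrite label_equator.
rewrite (eq_parity (psi := fan_coloring c' false)); last by move=> s; apply: TL.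
have -> : parity (fun s => fan_coloring c false (map equator (map antipode s))) z = parity (fan_coloring c' true) z.
  congr (odd _); apply: eq_in_count => s sz; rewrite TL.
  by rewrite (fan_antipode _ cP') ?gz ?coz.
exact: oz cP'.
Qed.

Lemma odd_sphere_exists k : exists z, odd_sphere k.+2 z.
Proof.
elim: k => [|k [z ez]]; first by eexists; apply: odd_sphere_base.
exact: odd_sphere_step ez.
Qed.

(** A simplex of the hemisphere has as many vertices as words have letters. *)
Lemma wide_coloring_bound k m c : wide_coloring k.+2 m c -> k.+2 <= m.
Proof.
move=> cP; have [z [cz _ /(_ c m cP) oz]] := odd_sphere_exists k.
have [b [s sz Ts]] : exists b, exists2 s, s \in z & fan_coloring c b s.
  have hasT b : parity (fan_coloring c b) z -> exists b, exists2 s, s \in z & fan_coloring c b s.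
    by rewrite /parity => pz; exists b; apply/hasP; rewrite has_count; case: (count _ z) pz.
  by case: (boolP (parity (fan_coloring c false) z)) oz => [/hasT//|_ /= /hasT].
case/and3P: (allP cz s sz) => /eqP sE gs cs; rewrite -sE.
rewrite -(size_map (label c)); apply: alternation_bound Ts.
  exact: unpaired_label cP gs cs.
rewrite all_map; apply/allP => w /(allP gs) gw /=; rewrite half_label.
by case: cP => cm _; apply/cm/unsigned_wide.
Qed.

(** * Graphs of maps *)

Lemma chromatic_numberP (G : sgraph) : colorable G (chromatic_number G).
Proof. by rewrite /chromatic_number; case: ex_minnP. Qed.

Lemma chromatic_number_le (G : sgraph) k : colorable G k -> chromatic_number G <= k.
Proof. by move=> ck; rewrite /chromatic_number; case: ex_minnP => m _ /(_ _ ck). Qed.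

Lemma colorableP (G : sgraph) k :
  reflect (exists c : G -> 'I_k, forall x y, edge x y -> c x != c y) (colorable G k).
Proof.
apply: (iffP existsP) => [[c /forallP cP] | [c cP]].
  by exists c => x y exy; move/forallP: (cP x) => /(_ y)/implyP; apply.
exists (finfun c); apply/forallP => x; apply/forallP => y.
by apply/implyP => exy; rewrite !ffunE cP.
Qed.

(** The subgraph of the exponential graph induced by a family of maps.  Distinct
    indices are required so that no loop arises. *)
Section Maps.
Variables (G : sgraph) (k : nat) (I : finType) (f : I -> G -> 'I_k).

Definition maps_edge : rel I :=
  fun u v => (u != v) && [forall x : G, forall y : G, edge x y ==> (f u x != f v y)].

Lemma maps_edge_sym : symmetric maps_edge.
Proof.
suff sub u v : maps_edge u v -> maps_edge v u by move=> u v; apply/idP/idP; apply: sub.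
case/andP=> neq /forallP fuv; rewrite /maps_edge eq_sym neq; apply/forallP => x.
apply/forallP => y; apply/implyP => exy; rewrite eq_sym.
by move/forallP: (fuv y) => /(_ x)/implyP; apply; rewrite edge_sym.
Qed.

Lemma maps_edge_irrefl : irreflexive maps_edge.
Proof. by move=> u; rewrite /maps_edge eqxx. Qed.

Definition maps_graph := SGraph maps_edge_sym maps_edge_irrefl.

Lemma tensor_maps_colorable : colorable (tensor_product G maps_graph) k.
Proof.
apply/colorableP; exists (fun p => f p.2 p.1) => -[x u] [y v] /andP[/= exy].
by case/andP=> _ /forallP/(_ x)/forallP/(_ y)/implyP; apply.
Qed.
End Maps.

(** * The graph with 4686 vertices *)
Fixpoint words n : seq (seq nat) :=
  if n is m.+1 then [seq p :: w | p <- iota 0 5, w <- words m] else [:: [::]].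

Lemma words_uniq n : uniq (words n).
Proof.
elim: n => [//|n IH]; apply: (allpairs_uniq (iota_uniq 0 5) IH).
by move=> [p u] [q v] _ _ [-> ->].
Qed.

Lemma mem_words n x : size x = n -> all (leq^~ 4) x -> x \in words n.
Proof.
elim: n x => [|n IH] [|p x] // [sz] /andP[p4 al].
by apply: (allpairs_f cons); [rewrite (mem_iota 0 5) | apply: IH].
Qed.

Definition wide_words := [seq x <- words 6 | wide_word 6 x].

Lemma mem_wide_words x : wide_word 6 x -> x \in wide_words.
Proof.
move=> wx; rewrite mem_filter wx; case/and4P: wx => /eqP sz al _ _.
exact: mem_words.
Qed.

Lemma size_wide_words : size wide_words = 4686.
Proof. by apply/eqP; vm_compute. Qed.

Definition wide_edge : rel (seq_sub wide_words) := fun x y => wide_adj (ssval x) (ssval y).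

Lemma wide_vertex (x : seq_sub wide_words) : wide_word 6 (ssval x).
Proof. by have := ssvalP x; rewrite mem_filter => /andP[]. Qed.

Lemma wide_adj_sym : symmetric wide_adj.
Proof.
rewrite /wide_adj; elim=> [|p x IH] [|q y] //=; rewrite IH /step andbC [RHS]andbC.
by rewrite /near [(p == 4) && _]andbC [(p.+1 == q) || _]orbC.
Qed.

Lemma wide_edge_sym : symmetric wide_edge.
Proof. by move=> x y; apply: wide_adj_sym. Qed.

Lemma wide_edge_irrefl : irreflexive wide_edge.
Proof.
move=> x; have /and4P[_ _ ct _] := wide_vertex x; apply/negP => xx.
have: 0 \in ssval x by rewrite -has_pred1 has_count (eqP ct).
move: xx; rewrite /wide_edge /wide_adj; elim: (ssval x) => [|p w IH] //= /andP[pp ww].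
by rewrite inE => /orP[/eqP p0|/IH]; [rewrite -p0 in pp | apply].
Qed.

Definition wide_graph := SGraph wide_edge_sym wide_edge_irrefl.

Lemma card_wide_graph : #|wide_graph| = 4686.
Proof. exact: etrans (card_seq_sub (filter_uniq _ (words_uniq 6))) size_wide_words. Qed.

Lemma wide_graph_chromatic : 5 < chromatic_number wide_graph.
Proof.
have /colorableP[c cP] := chromatic_numberP wide_graph.
pose c' x := if insub x is Some v then val (c v) else 0.
have c'E x (wx : wide_word 6 x) : c' x = c (SeqSub (mem_wide_words wx)).
  by rewrite /c' insubT ?mem_wide_words // => xw; congr (val (c _)); apply: val_inj.
apply: (@wide_coloring_bound 4 _ c'); split=> [x wx | x y wx wy axy].
  by rewrite c'E ltn_ord.
by rewrite !c'E; apply: cP.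
Qed.

(** * The graph with 30 vertices *)

(** The vertices at distance at most [t] from the class [i], in the parity
    of [t]. *)
Definition shell i t (x : seq nat) := (nth 4 x i <= t) && (odd (nth 4 x i) == odd t).

Lemma wide_adj_nth x y i : wide_adj x y -> step (nth 4 x i) (nth 4 y i).
Proof.
by rewrite /wide_adj; elim: x y i => [|p x IH] [|q y] [|i] //= /andP[pq xy]; last exact: IH.
Qed.

Lemma shell_indep x y i t : t <= 3 -> wide_adj x y -> shell i t x -> ~~ shell i t y.
Proof.
move=> t3 /(wide_adj_nth i)/orP[/nearP npq|/andP[/eqP p4 _]] /andP[pt /eqP po].
  by apply/negP => /andP[qt /eqP qo]; move: po qo; case: npq => <- /=; case: (odd t); case: (odd _).
by move: pt; rewrite p4; lia.
Qed.

Lemma shell_next x y i t : t <= 3 -> wide_adj x y -> shell i t x -> shell i t.+1 y.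
Proof.
move=> t3 /(wide_adj_nth i)/orP[/nearP npq|/andP[/eqP p4 _]] /andP[pt /eqP po].
  rewrite /shell; apply/andP; split; first by lia.
  by move: po; case: npq => <- /=; [move=> -> | move=> <-]; rewrite ?negbK.
by move: pt; rewrite p4; lia.
Qed.

(** The unique letter 0 sits in the place of the class of [x]; classes are
    grouped as 01, 23, 45. *)
Definition hub (x : seq nat) := (index 0 x)./2.

Definition shells a t x := shell a.*2 t x || shell a.*2.+1 t x.

Definition next_low a := a.+1 %% 3.
Definition last_low a := a.+2 %% 3.

(** The classes of [a] are distinguished only here, where both have been
    followed up to distance 3. *)
Definition split_map a o x :=
  if shell a.*2 3 x then a else if shell a.*2.+1 3 x then next_low a else o.

Definition gadget a (j : nat) x :=
  match j with
  | 0 => if shells a 1 x then 3 else a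
  | 1 => if shells a 1 x then 4 else a
  | 2 => if shells a 2 x then 4 else 3
  | 3 => if shells a 2 x then 3 else 4
  | 4 => if shells a 2 x then last_low a else 4
  | 5 => split_map a 3 x
  | 6 => split_map a 4 x
  | _ => split_map a (last_low a) x
  end.

Definition small_index : finType := ('I_5 + (unit + 'I_3 * 'I_8))%type.

Definition small_map (v : small_index) (x : seq nat) : nat :=
  match v with
  | inl c => c
  | inr (inl _) => hub x
  | inr (inr (a, j)) => gadget a j x
  end.

Definition small_graph :=
  maps_graph (G := wide_graph) (fun v x => inord (small_map v (ssval x)) : 'I_5).

Lemma card_small_graph : #|small_graph| = 30.
Proof. by rewrite /= !card_sum card_prod !card_ord card_unit. Qed.

Lemma hub_lt3 x : wide_word 6 x -> hub x < 3.
Proof.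
case/and4P=> /eqP sz _ ct _; rewrite /hub ltn_half_double -[3.*2]sz index_mem.
by rewrite -has_pred1 has_count (eqP ct).
Qed.

Lemma small_map_lt5 v x : wide_word 6 x -> small_map v x < 5.
Proof.
move=> wx; case: v => [c|[_|[[[|[|[|a]]] //= _] [j _]]]] /=; first exact: ltn_ord.
  by apply: leq_trans (hub_lt3 wx) _.
all: by case: j => [|[|[|[|[|[|[|j]]]]]]]; rewrite /gadget /split_map; do ?case: ifP.
Qed.

Lemma small_edge (u v : small_graph) : u != v ->
  (forall x y, wide_word 6 x -> wide_word 6 y -> wide_adj x y ->
     small_map u x != small_map v y) ->
  edge u v.
Proof.
move=> neq uv; apply/andP; split=> //; apply/forallP => x; apply/forallP => y.
apply/implyP => xy; apply: contraNneq (uv _ _ (wide_vertex x) (wide_vertex y) xy).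
by move/(congr1 val); rewrite /= !inordK ?small_map_lt5 ?wide_vertex // => ->.
Qed.

Definition constant_vertex (c : 'I_5) : small_graph := inl c.
Definition hub_vertex : small_graph := inr (inl tt).
Definition gadget_vertex (a : 'I_3) j : small_graph := inr (inr (a, inord j)).

Lemma shells_next a x y t : t <= 3 -> wide_adj x y -> shells a t x -> shells a t.+1 y.
Proof. by move=> t3 xy /orP[] /(shell_next t3 xy) sy; rewrite /shells sy ?orbT. Qed.

Lemma hub_shells x : wide_word 6 x -> shells (hub x) 0 x.
Proof.
case/and4P=> _ _ ct _; have x0 : 0 \in x by rewrite -has_pred1 has_count (eqP ct).
have : shell (index 0 x) 0 x by rewrite /shell nth_index.
rewrite -{1}[index 0 x]odd_double_half -/(hub x) /shells.
by case: (odd _); rewrite ?add1n ?add0n => ->; rewrite ?orbT.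
Qed.

Lemma next_low_lt a : next_low a < 3. Proof. exact: ltn_pmod. Qed.
Lemma last_low_lt a : last_low a < 3. Proof. exact: ltn_pmod. Qed.

Lemma low_distinct a : a < 3 -> [&& a != next_low a, a != last_low a & next_low a != last_low a].
Proof. by case: a => [|[|[|a]]]. Qed.

Lemma base_hub a b x y : a < 3 -> 3 <= b -> wide_word 6 y -> wide_adj x y ->
  (if shells a 1 x then b else a) != hub y.
Proof.
move=> a3 b3 wy xy; have h3 := hub_lt3 wy; case: ifP => [_|s1]; first by apply/eqP; lia.
apply: contraFneq s1 => ->; apply: (shells_next (t := 0)) (hub_shells wy) => //.
by rewrite wide_adj_sym.
Qed.

Lemma next_shells (a t p q r : nat) x y :
  t <= 3 -> p != q -> p != r -> q != r -> wide_adj x y ->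
  (if shells a t.+1 x then p else q) != (if shells a t y then q else r).
Proof.
move=> t3 pq pr qr xy; case: (boolP (shells a t y)) => [sy|_]; last by case: ifP.
by rewrite (shells_next t3 _ sy) // wide_adj_sym.
Qed.

Lemma split_shells (a o b : nat) x y :
  a != o -> a != b -> next_low a != o -> next_low a != b -> o != b ->
  wide_adj x y -> split_map a o x != (if shells a 2 y then o else b).
Proof.
move=> ao ab so sb ob xy; rewrite /split_map; case: (boolP (shells a 2 y)) => [sy|_].
  have: shells a 3 x by apply: shells_next sy => //; rewrite wide_adj_sym.
  by rewrite /shells => /orP[->|->] //; case: ifP.
by do ?case: ifP.
Qed.

(** On S_3 each of the two classes is independent, so equal values a, or equal
    values [next_low a], never face each other across an edge. *)
Lemma split_split (a o o' : nat) x y : a != next_low a -> a != o -> a != o' ->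
  next_low a != o -> next_low a != o' -> o != o' ->
  wide_adj x y -> split_map a o x != split_map a o' y.
Proof.
move=> as' ao ao' so so' oo xy; rewrite /split_map.
have ind i : shell i 3 x -> ~~ shell i 3 y by apply: shell_indep.
case: ifP => [/ind/negbTE-> | _]; first by case: ifP.
case: ifP => [/ind/negbTE-> | _]; first by case: ifP => // _; rewrite eq_sym.
by do ?case: ifP => // _; rewrite eq_sym.
Qed.

Section NotColorable.
Variable col : small_graph -> 'I_5.
Hypothesis colP : forall u v, edge u v -> col u != col v.

Definition constant_color n := col (constant_vertex (inord n)).

Lemma constants_distinct : injective (fun c => col (constant_vertex c)).
Proof.
move=> c d /eqP E; apply: contraTeq E => neq; apply: colP; apply: small_edge.
  by apply: contraNneq neq => -[->].
by move=> x y _ _ _.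
Qed.

(** The five constants use up the five colours, and a map is adjacent to every
    constant that is not among its values. *)
Lemma col_image (v : small_graph) (L : seq nat) :
  (forall c, v != constant_vertex c) ->
  (forall x, wide_word 6 x -> small_map v x \in L) -> exists2 c, c \in L & col v = constant_color c.
Proof.
move=> vc vL; have [g _ gK] := injF_bij constants_distinct.
exists (val (g (col v))); last by rewrite /constant_color inord_val gK.
rewrite -(negbK (_ \in _)); apply/negP => notL.
have := colP (u := v) (v := constant_vertex (g (col v))); rewrite gK eqxx => /(_ _)/negP[] //.
apply: small_edge => // x y wx _ _.
by apply: contraNneq notL => /= E; rewrite -[X in X \in _]E; apply: vL.
Qed.

(** The hub is coloured like some constant a < 3.  This forces the maps 0 and 1
    of the gadget of a to be coloured 3 and 4, then the maps 2, 3 and 4 to be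
    coloured 4, 3 and [last_low a], and leaves the triangle formed by the maps 5, 6
    and 7 with the colours a and [next_low a] only. *)
Lemma small_graph_not_colored : False.
Proof.
have [a] : exists2 a, a \in [:: 0; 1; 2] & col hub_vertex = constant_color a.
  apply: col_image => // x wx; move: (hub_lt3 wx) => /=.
  by case: (hub x) => [|[|[|]]].
have -> : (a \in [:: 0; 1; 2]) = (a < 3) by case: a => [|[|[|]]].
move=> a3 hubE; pose g j := gadget_vertex (inord a) j.
have gE j x : j < 8 -> small_map (g j) x = gadget a j x by move=> j8; rewrite /= !inordK.
have s3 := next_low_lt a; have t3 := last_low_lt a.
have /and3P[a_s a_t s_t] := low_distinct a3.
have low_high b c : b < 3 -> 3 <= c -> b != c.
  by move=> b3 c3; rewrite neq_ltn (leq_trans b3 c3).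
have gcol j (L : seq nat) : j < 8 -> (forall x, gadget a j x \in L) ->
    exists2 c, c \in L & col (g j) = constant_color c.
  by move=> j8 jL; apply: col_image => // x _; rewrite gE.
have gedge j j' : j < 8 -> j' < 8 -> j != j' ->
    (forall x y, wide_adj x y -> gadget a j x != gadget a j' y) -> col (g j) != col (g j').
  move=> j8 j8' neq jj; apply/colP/small_edge => [|x y _ _ xy]; last by rewrite !gE ?jj.
  by apply: contraNneq neq => -[/(congr1 val)]; rewrite /= !inordK // => ->.
have two j c d : j < 8 -> (forall x, gadget a j x \in [:: c; d]) ->
    col (g j) != constant_color d -> col (g j) = constant_color c.
  move=> j8 jL neq; have [e] := gcol _ _ j8 jL; rewrite !inE => /orP[] /eqP-> //.
  by move=> E; rewrite E eqxx in neq.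
have ite (b : bool) (c d : nat) : (if b then c else d) \in [:: c; d].
  by case: b; rewrite !inE eqxx ?orbT.
have hubN j : j < 2 -> col (g j) != constant_color a.
  move=> j2; rewrite -hubE; apply/colP/small_edge => // x y _ wy xy.
  rewrite gE; last exact: leq_trans j2 _.
  by case: j j2 => [|[|]] // _; apply: base_hub.
have E0 : col (g 0) = constant_color 3 by apply: (two _ _ a) => [//|x|]; [exact: ite | exact: hubN].
have E1 : col (g 1) = constant_color 4 by apply: (two _ _ a) => [//|x|]; [exact: ite | exact: hubN].
have E2 : col (g 2) = constant_color 4.
  apply: (two _ _ 3) => [//|x|]; first exact: ite.
  by rewrite -E0; apply: gedge => // x y; apply: next_shells => //; rewrite eq_sym low_high.
have E3 : col (g 3) = constant_color 3.
  apply: (two _ _ 4) => [//|x|]; first exact: ite.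
  by rewrite -E1; apply: gedge => // x y; apply: next_shells => //; rewrite eq_sym low_high.
have E4 : col (g 4) = constant_color (last_low a).
  apply: (two _ _ 4) => [//|x|]; first exact: ite.
  rewrite -E1; apply: gedge => // x y; apply: next_shells => //.
  - exact: low_high.
  - by rewrite eq_sym.
  - by rewrite eq_sym low_high.
have split_col j o : j < 8 -> (forall x, gadget a j x = split_map a o x) ->
    col (g j) != constant_color o -> (col (g j) == constant_color a) || (col (g j) == constant_color (next_low a)).
  move=> j8 jE neq; have [|c] := gcol j [:: a; next_low a; o] j8.
    by move=> x; rewrite jE /split_map; do ?case: ifP; rewrite !inE eqxx ?orbT.
  rewrite !inE => /or3P[] /eqP-> E; rewrite E ?eqxx ?orbT //.
  by rewrite E eqxx in neq.
have Q5 := split_col 5 3 isT (fun=> erefl).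
have Q6 := split_col 6 4 isT (fun=> erefl).
have Q7 := split_col 7 (last_low a) isT (fun=> erefl).
have {}Q5 : (col (g 5) == constant_color a) || (col (g 5) == constant_color (next_low a)).
  by apply: Q5; rewrite -E3; apply: gedge => // x y; apply: split_shells => //; apply: low_high.
have {}Q6 : (col (g 6) == constant_color a) || (col (g 6) == constant_color (next_low a)).
  by apply: Q6; rewrite -E2; apply: gedge => // x y; apply: split_shells => //; apply: low_high.
have {}Q7 : (col (g 7) == constant_color a) || (col (g 7) == constant_color (next_low a)).
  by apply: Q7; rewrite -E4; apply: gedge => // x y; apply: split_shells => //; apply: low_high.
have N56 : col (g 5) != col (g 6) by apply: gedge => // x y; apply: split_split => //; apply: low_high.
have N75 : col (g 7) != col (g 5) by apply: gedge => // x y; apply: split_split => //; apply: low_high.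
have N76 : col (g 7) != col (g 6) by apply: gedge => // x y; apply: split_split => //; apply: low_high.
move: N56 N75 N76.
by case/orP: Q5 => /eqP ->; case/orP: Q6 => /eqP ->; case/orP: Q7 => /eqP ->; rewrite ?eqxx.
Qed.
End NotColorable.

Lemma small_graph_chromatic : 5 < chromatic_number small_graph.
Proof.
rewrite ltnNge; apply/negP => le5.
have /colorableP[c cP] := chromatic_numberP small_graph.
apply: (@small_graph_not_colored (fun v => widen_ord le5 (c v))) => u v /cP.
by apply: contraNneq => /(congr1 val)/= E; apply/eqP/val_inj.
Qed.

Theorem mainTheorem1 :
  exists G H : sgraph,
    [/\ #|G| = 4686, #|H| = 30,
        5 < chromatic_number G, 5 < chromatic_number H
      & chromatic_number (tensor_product G H) <= 5].
Proof.
exists wide_graph, small_graph; split.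
- exact: card_wide_graph.
- exact: card_small_graph.
- exact: wide_graph_chromatic.
- exact: small_graph_chromatic.
- by apply/chromatic_number_le/tensor_maps_colorable.
Qed.
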